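(* Let $M$ be a loopless matroid with ground set $E$, and let $\Lambda$ be the lattice with basis $\{u_F\}$ indexed by the nonempty flats $F$ of $M$. Then there is an equality of polynomials on $\Lambda$ $$\mathrm{Snap}_M=T^{u_E}\cdot\mathrm{Poch}^{\uparrow}(\mathrm{Vol}_M),$$ where the Pochhammer transform is taken with respect to the basis $\{u_F\}$.
   Context: Let $r$ be the rank of $M$ and $d=r-1$. Let $N=\mathbb{Z}^E/\mathbb{Z}(1,\dots,1)$ and for a nonempty proper flat $G$ let $v_G$ be the image of $\sum_{i\in G}e_i$. The Bergman fan $\Sigma_M$ in $N_{\mathbb{R}}$ has one cone $\mathrm{cone}(v_{G_1},\dots,v_{G_k})$ for each chain $G_1\subsetneq\dots\subsetneq G_k$ of nonempty proper flats. Let $X_{\Sigma_M}$ be its (smooth) toric variety, $D_G$ the torus-invariant divisor of the ray $v_G$, $K(M)=K(X_{\Sigma_M})$ its Grothendieck ring of vector bundles and $A(M)=A(X_{\Sigma_M})$ its Chow ring. The degree map $\deg_M\colon A^{d}(M)\to\mathbb{Z}$ is the homomorphism with $\deg_M([D_{G_1}]\cdots[D_{G_d}])=1$ for every maximal chain $G_1\subsetneq\dots\subsetneq G_d$ of nonempty proper flats. The Euler characteristic $\chi_M\colon K(M)\to\mathbb{Z}$ is the unique group homomorphism with $\chi_M\big(\prod_{j=1}^k(1-[\mathcal{O}(-D_{G_j})])\big)=1$ for every (possibly empty) chain $G_1\subsetneq\dots\subsetneq G_k$ of nonempty proper flats. (If $M$ is realized by a hyperplane arrangement, $K(M)$ and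 $A(M)$ are the $K$-ring and Chow ring of its wonderful compactification, $\chi_M$ is the holomorphic Euler characteristic and $\deg_M$ the usual degree.) For a nonempty flat $F$, $\mathcal{L}_F$ is the line bundle $\mathcal{O}\big(\sum_{G\ni i,\;G\not\supseteq F}D_G\big)$ on $X_{\Sigma_M}$, where $i\in F$ is any element and the sum is over nonempty proper flats $G$ with $i\in G$, $F\not\subseteq G$ (its isomorphism class does not depend on $i$; for $F=E$ the sum is over all nonempty proper flats containing $i$). (In the realizable case, $\mathcal{L}_F$ restricts to the pullback of $\mathcal{O}(1)$ along the map from the wonderful compactification to the projectivization of the image of the linear space in the coordinate space indexed by $F$.) For $(t_F)\in\Lambda$ (coordinates in the basis $u_F$) set $$\mathrm{Snap}_M((t_F))=\chi_M\Big(\prod_F[\mathcal{L}_F]^{t_F}\Big),\qquad \mathrm{Vol}_M((t_F))=\frac{1}{d!}\deg_M\Big(\big(\sum_F t_F\,c_1(\mathcal{L}_F)\big)^d\Big),$$ which are polynomial functions on $\Lambda$. $T^{u}$ is the shift operator $(T^uh)(x)=h(x+u)$. $\mathrm{Poch}^{\uparrow}$ is the $\mathbb{Q}$-linear endomorphism of $\mathbb{Q}[t_F]$ sending $\prod_F t_F^{k_F}$ to $\prod_F t_F(t_F+1)\cdots(t_F+k_F-1)$. *)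

(* Defs.v *)
From HB Require Import structures.
From mathcomp Require Import all_boot all_order all_algebra.
From mathcomp Require Import ring_quotient mpoly.
From mathcomp Require Import boolp.

Set Implicit Arguments.
Unset Strict Implicit.
Unset Printing Implicit Defensive.

Import GRing.Theory.
Local Open Scope ring_scope.
Local Open Scope quotient_scope.

(* A matroid on the ground set E, given by its rank function. *)
Record matroid (E : finType) := Matroid {
  rk :> {set E} -> nat;
  rk_card : forall A, (rk A <= #|A|)%N;
  rk_mono : forall A B : {set E}, A \subset B -> (rk A <= rk B)%N;
  rk_submod : forall A B : {set E},
    (rk (A :|: B) + rk (A :&: B) <= rk A + rk B)%N
}.

Definition loopless (E : finType) (M : matroid E) :=
  forall x : E, M [set x] != 0%N.

Definition flat (E : finType) (M : matroid E) (F : {set E}) :=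
  [forall x, (x \notin F) ==> (M F < M (x |: F))%N].

Definition nonempty_flat (E : finType) (M : matroid E) :=
  {F : {set E} | flat M F && (F != set0)}.

Definition proper_flat (E : finType) (M : matroid E) :=
  {G : {set E} | [&& flat M G, G != set0 & G != [set: E]]}.

(* The dimension r - 1 of the Bergman fan. *)
Definition fan_dim (E : finType) (M : matroid E) : nat := (M [set: E]).-1.

(* The ideal generated by the elements satisfying [gen]. *)
Inductive in_ideal (R : comNzRingType) (gen : R -> Prop) : R -> Prop :=
| in_ideal0 : in_ideal gen 0
| in_idealD a g p : gen g -> in_ideal gen p -> in_ideal gen (a * g + p).

Definition ideal_of (R : comNzRingType) (gen : R -> Prop) : {pred R} :=
  fun p => `[< in_ideal gen p >].

Lemma ideal_of_closed (R S : comNzRingType) (gen : R -> Prop)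
    (f : {rmorphism R -> S}) :
  (forall g, gen g -> f g = 0) -> idealr_closed (ideal_of gen).
Proof.
move=> f0; split.
- exact/asboolP/in_ideal0.
- apply/negP => /asboolP h.
  suff: f 1 = 0 by rewrite rmorph1 => /eqP; rewrite oner_eq0.
  elim: h => [|a g p /f0 fg _ fp]; first by rewrite rmorph0.
  by rewrite rmorphD rmorphM fg fp mulr0 addr0.
- move=> a u v /asboolP hu /asboolP hv; apply/asboolP.
  elim: hu => [|b g p hg _ IH]; first by rewrite mulr0 add0r.
  by rewrite mulrDr mulrA -addrA; apply: in_idealD.
Qed.

Section BergmanFan.
Variables (E : finType) (M : matroid E).

(* Representative in Z^E of the primitive generator v_G of the ray of G. *)
Definition ray_vector (G : proper_flat M) (e : E) : int := (e \in val G)%:Z.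

(* The cones of the fan are spanned by the chains of nonempty proper flats. *)
Definition is_cone (C : {set proper_flat M}) : bool :=
  [forall G in C, forall H in C,
     (val G \subset val H) || (val H \subset val G)].

(* The dual of N = Z^E / Z(1,..,1), and its pairing with v_G. *)
Definition in_dual_lattice (m : E -> int) := \sum_e m e = 0.

Definition pairing (m : E -> int) (G : proper_flat M) : int :=
  \sum_e m e * ray_vector G e.

(* A torus-invariant divisor \sum_G (D G) D_G. *)
Definition divisor := proper_flat M -> int.

(* The divisor whose associated line bundle is L_F, computed with i \in F. *)
Definition L_divisor (F : nonempty_flat M) (i : E) : divisor :=
  fun G => ((i \in val G) && ~~ (val F \subset val G))%:Z.

(* Chow ring: the presentation Z[x_G] / (Stanley-Reisner + linear relations)
   of the Chow ring of the smooth toric variety of the fan; x_G = [D_G]. *)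
Definition chow_poly := {mpoly int[#|{: proper_flat M}|]}.

Definition chow_var (G : proper_flat M) : chow_poly := 'X_(enum_rank G).

Variant chow_rel : chow_poly -> Prop :=
| chow_rel_SR C of ~~ is_cone C : chow_rel (\prod_(G in C) chow_var G)
| chow_rel_lin m of in_dual_lattice m :
    chow_rel (\sum_G chow_var G *~ pairing m G).

Definition chow_ideal : {pred chow_poly} := ideal_of chow_rel.

Lemma is_cone_set0 : is_cone set0.
Proof. by apply/forall_inP => G; rewrite inE. Qed.

Lemma chow_ideal_closed : idealr_closed chow_ideal.
Proof.
apply: (@ideal_of_closed _ _ _ (meval (fun=> 0 : int))) => g [C CP|m _].
  have [C0|[G GC]] := set_0Vmem C; first by rewrite C0 is_cone_set0 in CP.
  by rewrite rmorph_prod (bigD1 G) //= mevalXU mul0r.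
by rewrite rmorph_sum big1 // => G _; rewrite rmorphMz /= mevalXU mul0rz.
Qed.

HB.instance Definition _ := isIdealr.Build chow_poly chow_ideal chow_ideal_closed.

Definition chow_ring := {ideal_quot chow_ideal}.

HB.instance Definition _ := GRing.ComNzRing.on chow_ring.

Definition chow_class (p : chow_poly) : chow_ring := \pi_chow_ring p.

Definition chow_D (G : proper_flat M) : chow_ring := chow_class (chow_var G).

Definition chow_graded (k : nat) : {pred chow_ring} :=
  fun a => `[< exists2 p : chow_poly, p \is k.-homog & a = chow_class p >].

(* First Chern class of the line bundle O(D). *)
Definition c1 (D : divisor) : chow_ring := \sum_G chow_D G *~ D G.

(* K-ring: the presentation of K(X) for the smooth toric variety of the fan, as
   a quotient of the Laurent polynomial ring on the classes [O(-D_G)].  The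
   variable indexed by (G, true) is [O(-D_G)], the one indexed by (G, false)
   is its inverse [O(D_G)]. *)
Definition K_poly := {mpoly int[#|{: proper_flat M * bool}|]}.

Definition K_var (G : proper_flat M) (b : bool) : K_poly :=
  'X_(enum_rank (G, b)).

(* [K_rel_char]: the bundle O(div chi^m) is trivial; positive and negative
   exponents of [O(D_G)] are expressed through the two families of variables. *)
Variant K_rel : K_poly -> Prop :=
| K_rel_inv G : K_rel (K_var G true * K_var G false - 1)
| K_rel_SR C of ~~ is_cone C : K_rel (\prod_(G in C) (1 - K_var G true))
| K_rel_char m of in_dual_lattice m :
    K_rel (\prod_G K_var G (pairing m G < 0) ^+ `|pairing m G|%N - 1).

Definition K_ideal : {pred K_poly} := ideal_of K_rel.

Lemma K_ideal_closed : idealr_closed K_ideal.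
Proof.
apply: (@ideal_of_closed _ _ _ (meval (fun=> 1 : int))) => g [G|C CP|m _].
- by rewrite rmorphB rmorphM rmorph1 /= !mevalXU mulr1 subrr.
- have [C0|[G GC]] := set_0Vmem C; first by rewrite C0 is_cone_set0 in CP.
  by rewrite rmorph_prod (bigD1 G) //= rmorphB rmorph1 /= mevalXU subrr mul0r.
- rewrite rmorphB rmorph1 rmorph_prod big1 ?subrr // => G _.
  by rewrite rmorphXn /= mevalXU expr1n.
Qed.

HB.instance Definition _ := isIdealr.Build K_poly K_ideal K_ideal_closed.

Definition K_ring := {ideal_quot K_ideal}.

HB.instance Definition _ := GRing.ComNzRing.on K_ring.

(* Invertible elements, so that integer powers x ^ n make sense in K_ring. *)
Definition K_unit : {pred K_ring} := fun x => `[< exists y, y * x = 1 >].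

Definition K_inv (x : K_ring) : K_ring :=
  if pselect (exists y, y * x = 1) is left ex then projT1 (cid ex) else x.

Lemma K_mulVr : {in K_unit, left_inverse 1 K_inv *%R}.
Proof.
move=> x /asboolP ex; rewrite /K_inv.
by case: pselect => // ex'; case: cid.
Qed.

Lemma K_unitP x y : y * x = 1 -> x \in K_unit.
Proof. by move=> yx; apply/asboolP; exists y. Qed.

Lemma K_inv_out : {in [predC K_unit], K_inv =1 id}.
Proof. by move=> x /asboolP nex; rewrite /K_inv; case: pselect. Qed.

HB.instance Definition _ :=
  GRing.ComNzRing_hasMulInverse.Build K_ring K_mulVr K_unitP K_inv_out.

Definition K_class (p : K_poly) : K_ring := \pi_K_ring p.

(* The class [O(D)] of the line bundle of a divisor. *)
Definition K_O (D : divisor) : K_ring :=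
  \prod_G K_class (K_var G false) ^ D G.

Definition prime_divisor (G : proper_flat M) : divisor :=
  fun H => (H == G)%:Z.

Definition oppD (D : divisor) : divisor := fun G => - D G.

(* The degree map A^d(M) -> Z; values of [deg] outside A^d(M) are irrelevant. *)
Definition is_degree_map (deg : chow_ring -> int) : Prop :=
  {in chow_graded (fan_dim M) &, {morph deg : a b / a + b}} /\
  forall C : {set proper_flat M}, is_cone C -> #|C| = fan_dim M ->
    deg (\prod_(G in C) chow_D G) = 1.

Definition is_euler_char (chi : K_ring -> int) : Prop :=
  {morph chi : a b / a + b} /\
  forall C : {set proper_flat M}, is_cone C ->
    chi (\prod_(G in C) (1 - K_O (oppD (prime_divisor G)))) = 1.

(* The lattice Lambda, in coordinates with respect to the basis (u_F). *)
Definition Lambda := nonempty_flat M -> int.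

(* The basis vector u_F. *)
Definition basis_vec (F : {set E}) : Lambda := fun F' => (val F' == F)%:Z.

Definition Snap (chi : K_ring -> int) (i : nonempty_flat M -> E)
    (t : Lambda) : rat :=
  (chi (\prod_F K_O (L_divisor F (i F)) ^ t F))%:~R.

Definition Vol (deg : chow_ring -> int) (i : nonempty_flat M -> E)
    (t : Lambda) : rat :=
  ((fan_dim M)`!)%:R^-1 *
  (deg ((\sum_F c1 (L_divisor F (i F)) *~ t F) ^+ fan_dim M))%:~R.

(* Q[t_F], the coordinate t_F being 'X_(enum_rank F). *)
Definition Lambda_poly := {mpoly rat[#|{: nonempty_flat M}|]}.

Definition eval_Lambda (p : Lambda_poly) (t : Lambda) : rat :=
  p.@[fun k => (t (enum_val k))%:~R].

Definition shift (u : Lambda) (p : Lambda_poly) : Lambda_poly :=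
  p \mPo [tuple 'X_k + ((u (enum_val k))%:~R)%:MP | k < #|{: nonempty_flat M}|].

(* Linear extension of \prod_k X_k^(m k) |->
   \prod_k X_k (X_k + 1) ... (X_k + m k - 1). *)
Definition Poch_up (p : Lambda_poly) : Lambda_poly :=
  \sum_(m <- msupp p)
    p@_m *: \prod_k \prod_(j < m k) ('X_k + (j%:R)%:MP).

End BergmanFan.

Arguments basis_vec {E} M F.

(* Main.v *)
Require Import Defs.
From HB Require Import structures.
From mathcomp Require Import all_boot all_order all_algebra.
From mathcomp Require Import ring_quotient mpoly.
From mathcomp Require Import boolp ssrcomplements zify ring lra.

(* Write [eta_F = 1 - [L_F]^-1] and [xi_G = 1 - [O(-D_G)]].  Choosing the point
   [i] in [F] outside the largest flat of a chain [C] not containing [F], one can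
   expand [xi_C * eta_F] over longer chains; the outcome is that
   [chi(xi_C * eta_F)] is 1 if [C] is a chain of flats of the principal
   truncation of [M] along [F], and 0 otherwise.  Iterating, [chi] of a product
   of [eta_F]'s is 1 or 0 according to whether the iterated truncation of [M] has
   no loops, and the same computation gives the degree of a product of [fan_dim]
   classes [c1(L_F)].

   The backward difference in direction [u_F] multiplies the class of a line
   bundle by [eta_F], whereas the Pochhammer transform turns it into the partial
   derivative, which multiplies by [c1(L_F)].  So the products of [eta_F]'s
   twisted by [L^t] and the corresponding partial derivatives of the volume
   polynomial satisfy the same difference equations, and it suffices to compare
   them at [t = - u_E], where both reduce to the numbers computed above. *)

Set Implicit Arguments.
Unset Strict Implicit.
Unset Printing Implicit Defensive.

Import Order.TTheory GRing.Theory Num.Theory.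
Local Open Scope ring_scope.

(** * Principal truncations of matroids *)

Section Matroids.
Variable E : finType.
Implicit Types (N : matroid E) (A B F G : {set E}) (x : E).

Lemma rk_set0 N : N set0 = 0%N.
Proof. by apply/eqP; rewrite -leqn0 -(cards0 E) rk_card. Qed.

Lemma rk_add1 N x A : (N (x |: A) <= (N A).+1)%N.
Proof.
have := rk_submod N [set x] A; have := rk_card N [set x]; rewrite cards1; lia.
Qed.

(** Submodularity for [A :|: G] and [B]: their union is [B :|: G] and their intersection contains
    [A]. *)
Lemma rk_spanU N A B G : N (A :|: G) = N A -> A \subset B -> N (B :|: G) = N B.
Proof.
move=> sp AB; have := rk_submod N (A :|: G) B.
have -> : A :|: G :|: B = B :|: G by rewrite setUAC (setUidPr AB).
have := rk_mono N (A := A) (B := (A :|: G) :&: B).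
rewrite subsetI subsetUl AB => /(_ isT).
have := rk_mono N (subsetUl B G); lia.
Qed.

(** Diminishing returns, from the same instance of submodularity as [rk_spanU]. *)
Lemma rk_marginal N F A B : A \subset B -> (N (B :|: F) + N A <= N (A :|: F) + N B)%N.
Proof.
move=> AB; have := rk_submod N (A :|: F) B.
rewrite setUAC (setUidPr AB).
have := rk_mono N (A := A) (B := (A :|: F) :&: B).
rewrite subsetI subsetUl AB => /(_ isT); lia.
Qed.

Lemma flatP N A : reflect (forall x, x \notin A -> (N A < N (x |: A))%N) (flat N A).
Proof. by apply: (iffP forall_inP). Qed.

Lemma rk_flat_proper N A B : flat N A -> A \proper B -> (N A < N B)%N.
Proof.
move=> /flatP fA /properP[AB [x xB xA]]; apply: leq_trans (fA x xA) _.
by apply: rk_mono; rewrite subUset sub1set xB.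
Qed.

Definition mclosure N A : {set E} := [set x | N (x |: A) == N A].

Lemma sub_mclosure N A : A \subset mclosure N A.
Proof.
by apply/subsetP => x xA; rewrite inE (setUidPr _) ?sub1set.
Qed.

(** The points of [B] are added one at a time: each adds nothing to [A], hence nothing to a larger
    set. *)
Lemma rk_mclosureU N A B : B \subset mclosure N A -> N (A :|: B) = N A.
Proof.
have [m] := ubnP #|B|; elim: m B => // m IH B cB BA.
have [->|[x xB]] := set_0Vmem B; first by rewrite setU0.
rewrite (cardsD1 x) xB ltnS in cB.
have eB : N (A :|: B :\ x) = N A.
  by apply: IH => //; apply: subset_trans BA; apply: subsetDl.
rewrite -(setD1K xB) (setUC [set x]) setUA -eB.
apply: rk_spanU (subsetUl A _); rewrite setUC.
by have := subsetP BA x xB; rewrite inE => /eqP.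
Qed.

Lemma sub_mclosureE N A B : (B \subset mclosure N A) = (N (A :|: B) == N A).
Proof.
apply/idP/eqP => [|sp]; first exact: rk_mclosureU.
apply/subsetP => x xB; rewrite inE eqn_leq andbC.
rewrite rk_mono ?subsetUr //= -sp rk_mono //.
by rewrite subUset subsetUl sub1set inE xB orbT.
Qed.

Lemma rk_mclosure N A : N (mclosure N A) = N A.
Proof. by rewrite -[RHS](rk_mclosureU (subxx _)) (setUidPr (sub_mclosure _ _)). Qed.

Lemma flat_mclosure N A : flat N (mclosure N A).
Proof.
apply/flatP => x; rewrite inE rk_mclosure => xA.
apply: (@leq_trans (N (x |: A))); last by rewrite rk_mono ?setUS ?sub_mclosure.
by rewrite ltn_neqAle eq_sym xA rk_mono ?subsetUr.
Qed.

Lemma mclosure_min N A G : flat N G -> A \subset G -> mclosure N A \subset G.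
Proof.
move=> /flatP fG AG; apply/subsetP => x; rewrite inE => /eqP xA.
apply: contraT => /fG; rewrite setUC (rk_spanU (A := A)) ?ltnn //.
by rewrite setUC.
Qed.

Lemma rk_flat_add1 N A x : flat N A -> x \notin A -> N (x |: A) = (N A).+1.
Proof. by move=> /flatP fA /fA h; have := rk_add1 N x A; lia. Qed.

(* A principal truncation presupposes that [F] has positive rank; otherwise
   [N] is left unchanged, which makes the construction total. *)
Definition trunc_rk N F A : nat :=
  (N A - ((0 < N F)%N && (N (A :|: F) == N A)))%N.

Lemma trunc_rk_card N F A : (trunc_rk N F A <= #|A|)%N.
Proof. by apply: leq_trans (leq_subr _ _) (rk_card _ _). Qed.

(** If [B] spans [F] and [A] does not, then [N A < N (A :|: F) <= N B], which makes up for the one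
    subtracted at [B]. *)
Lemma trunc_rk_mono N F A B :
  A \subset B -> (trunc_rk N F A <= trunc_rk N F B)%N.
Proof.
move=> AB; have := rk_mono N AB; rewrite /trunc_rk; case: (0 < N F)%N => /=; last lia.
have := rk_spanU (N := N) (G := F) ^~ AB.
have := rk_mono N (subsetUl A F); have := rk_mono N (setSU F AB).
by case: eqP => [e1|n1]; case: eqP => [e2|n2] h1 h2 h3 /=; try (have := h3 e1); lia.
Qed.

(** The delicate case is that [A] and [B] span [F] but [A :&: B] does not. Then submodularity is
    applied to [A :|: F] and [B :|: F], which meet in [(A :&: B) :|: F], a set of larger rank than
    [A :&: B]. Otherwise it suffices that spanning passes to supersets. *)
Lemma trunc_rk_submod N F A B :
  (trunc_rk N F (A :|: B) + trunc_rk N F (A :&: B)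
    <= trunc_rk N F A + trunc_rk N F B)%N.
Proof.
have := rk_submod N A B; rewrite /trunc_rk; case F0: (0 < N F)%N => /=; last lia.
(* A set spanning [F] has positive rank, so the subtraction of naturals is exact. *)
have spU X : N (X :|: F) = N X -> (0 < N X)%N.
  by move<-; apply: leq_trans F0 (rk_mono _ (subsetUr _ _)).
have := spU A; have := spU B; have := spU (A :|: B); have := spU (A :&: B).
have := rk_spanU (N := N) (G := F) ^~ (subsetUl A B).
have := rk_spanU (N := N) (G := F) ^~ (subsetUr A B).
have := rk_spanU (N := N) (G := F) ^~ (subsetIl A B).
have := rk_spanU (N := N) (G := F) ^~ (subsetIr A B).
have := rk_mono N (subsetUl (A :&: B) F).
have := rk_submod N (A :|: F) (B :|: F).
rewrite -setUIl setUACA setUid.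
have := rk_mono N (subsetUl (A :|: B) F).
have := rk_mono N (subsetIl A B); have := rk_mono N (subsetIr A B).
by do 4 case: eqP => /=; lia.
Qed.

Definition trunc N F : matroid E :=
  Matroid (trunc_rk_card N F) (@trunc_rk_mono N F) (trunc_rk_submod N F).

Lemma truncE N F A : (0 < N F)%N -> trunc N F A = (N A - (N (A :|: F) == N A))%N.
Proof. by rewrite /= /trunc_rk => ->. Qed.

(** The flats that disappear are those not containing [F] whose rank rises by exactly one on adding
    [F]: a point of [F] outside such an [A] already makes it span [F], so it gains no rank after
    truncation. *)
Lemma flat_trunc N F A : (0 < N F)%N ->
  flat (trunc N F) A =
    flat N A && ((F \subset A) || ((N A).+1 < N (A :|: F))%N).
Proof.
move=> F0; apply/flatP/andP => [fA|[/flatP fA FA] x xA].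
- have fNA : flat N A.
    apply/flatP => x xA; have := fA x xA; rewrite !truncE //.
    have := rk_mono N (subsetUr [set x] A).
    have := rk_spanU (N := N) (G := F) ^~ (subsetUr [set x] A).
    by do 2 case: eqP => /=; lia.
  split=> //; have [//|/subsetPn[x xF xA]] := boolP (F \subset A).
  have := fA x xA; rewrite !truncE // (rk_flat_add1 fNA xA) /=.
  have -> : x |: A :|: F = A :|: F.
    by rewrite -setUA; apply/setUidPr; rewrite sub1set inE xF orbT.
  have := rk_mono N (A := x |: A) (B := A :|: F).
  rewrite subUset subsetUl sub1set inE xF orbT (rk_flat_add1 fNA xA) => /(_ isT).
  by do 2 case: eqP => /=; lia.
- rewrite !truncE // (rk_flat_add1 _ xA); last exact/flatP.
  have [FA1|FA1] := boolP (F \subset A).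
    rewrite (setUidPl FA1) (setUidPl (subset_trans FA1 (subsetUr [set x] A))).
    rewrite (rk_flat_add1 _ xA); last exact/flatP.
    by have := leq_trans F0 (rk_mono N FA1); rewrite !eqxx; lia.
  rewrite (negbTE FA1) /= in FA.
  have : (N (A :|: F) <= N (x |: A :|: F))%N by rewrite rk_mono ?setSU ?subsetUr.
  by do 2 case: eqP => /=; lia.
Qed.

End Matroids.

(** * Chains of flats *)

Section Chains.
Variables (E : finType) (M : matroid E).
Implicit Types (N : matroid E) (A B F : {set E}) (C : {set proper_flat M}).
Implicit Types (G H : proper_flat M).

Lemma coneP C :
  reflect {in C &, forall G H, (val G \subset val H) || (val H \subset val G)}
          (is_cone C).
Proof.
apply: (iffP forall_inP) => [h G H GC HC|h G GC].
  by have /forall_inP := h G GC; apply.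
by apply/forall_inP => H HC; apply: h.
Qed.

Lemma is_coneS C C' : C \subset C' -> is_cone C' -> is_cone C.
Proof.
move=> /subsetP CC' /coneP h; apply/coneP => G H GC HC.
by apply: h; apply: CC'.
Qed.

(* [flat N set0] says that [N] has no loops. *)
Definition chain_of N C : bool :=
  [&& flat N set0, is_cone C & [forall G in C, flat N (val G)]].

Lemma chain_ofS N C C' : C \subset C' -> chain_of N C' -> chain_of N C.
Proof.
move=> CC' /and3P[N0 cC' /forall_inP fC']; apply/and3P; split=> //.
  exact: is_coneS cC'.
by apply/forall_inP => G GC; apply: fC'; apply: (subsetP CC').
Qed.

Lemma chain_of_set0 N : chain_of N set0 = flat N set0.
Proof.
rewrite /chain_of is_cone_set0 andTb andbC; case: forall_inP => // -[] G.
by rewrite inE.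
Qed.

(** [B] is the largest member of the chain not containing [F], or empty if there is none. *)
Lemma cone_cut C F : F != set0 -> is_cone C ->
  exists B : {set E}, [/\ B = set0 \/ (exists2 G, G \in C & val G = B),
    ~~ (F \subset B) &
    forall G, G \in C -> if F \subset val G then B \subset val G
                         else val G \subset B].
Proof.
move=> F0 /coneP cC.
have [[G0 G0C FG0]|nG] := pselect (exists2 G, G \in C & ~~ (F \subset val G)).
- pose P G := (G \in C) && ~~ (F \subset val G).
  have PG0 : P G0 by rewrite /P G0C.
  case: (arg_maxnP (fun G => #|val G|) PG0) => G /andP[GC FG] maxG.
  exists (val G); split=> //; first by right; exists G.
  move=> H HC; have cGH := cC G H GC HC; case: ifPn => FH.
    by case/orP: cGH => // HG; rewrite (subset_trans FH HG) in FG.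
  case/orP: cGH => // GH; have /(_ H) := maxG; rewrite /P HC FH => /(_ isT) le.
  by have /eqP -> : val G == val H by rewrite eqEcard GH.
- exists set0; split; [by left| by rewrite subset0|].
  move=> G GC; case: ifPn => [_|FG]; first exact: sub0set.
  by case: nG; exists G.
Qed.

(** For [i] in [F]: no member of [C] is a component of the divisor of [L_F] computed at [i], so
    multiplying the stratum of [C] by that divisor produces no repeated factor. *)
Definition avoids i F C : Prop := forall G, G \in C -> i \in val G -> F \subset val G.

Lemma avoid_cone C F : F != set0 -> is_cone C -> exists2 i, i \in F & avoids i F C.
Proof.
move=> F0 cC; have [B [_ /subsetPn[i iF iB] hB]] := cone_cut F0 cC.
exists i => // G GC iG; have := hB G GC; case: ifP => // _ /subsetP/(_ i iG).
by rewrite (negbTE iB).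
Qed.

Definition L_support i F : {set proper_flat M} :=
  [set G : proper_flat M | (i \in val G) && ~~ (F \subset val G)].

Lemma L_support_disjoint i F C C' :
  avoids i F C -> C' \subset L_support i F -> [disjoint C & C'].
Proof.
move=> avC /subsetP sC'; rewrite disjoint_subset; apply/subsetP => G GC.
rewrite inE; apply/negP => /sC'; rewrite inE => /andP[iG /negP[]].
exact: avC.
Qed.

(** Let [B] cut [C] at [F], and let [m] be the closure of [B] and [i]. Every flat that contains [i]
    and extends the chain lies above [m]. If [F] is not below [m], then [m] is itself admissible and
    compatible with every extension; this is when [C] survives truncation. If [F] is below [m], each
    extending flat would contain [F], so there are none. *)
Lemma chain_of_trunc N F C i :
    (forall A, flat N A -> flat M A) -> i \in F -> avoids i F C ->
    chain_of N C ->
  if chain_of (trunc N F) C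
  then exists2 m, m \in L_support i F &
    forall C', C' \subset L_support i F -> chain_of N (C :|: C') ->
      chain_of N (m |: (C :|: C'))
  else forall C', C' \subset L_support i F -> C' != set0 ->
      ~~ chain_of N (C :|: C').
Proof.
move=> NM iF avC /and3P[N0 cC /forall_inP fC].
have Fn0 : F != set0 by apply/set0Pn; exists i.
have F0 : (0 < N F)%N.
  by rewrite -{1}(rk_set0 N) rk_flat_proper // properEneq eq_sym Fn0 sub0set.
have [B [BC FB hB]] := cone_cut Fn0 cC.
have iB : i \notin B.
  apply/negP => iB; case: BC => [B0|[G GC GB]]; first by rewrite B0 inE in iB.
  by rewrite -GB (avC G) ?GB in FB.
have fB : flat N B by case: BC => [->//|[G GC <-]]; apply: fC.
pose m := mclosure N (i |: B).
have fm : flat N m by apply: flat_mclosure.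
have im : i \in m by rewrite (subsetP (sub_mclosure _ _)) ?setU11.
have Bm : B \subset m by rewrite (subset_trans _ (sub_mclosure _ _)) ?subsetUr.
(* [H] is comparable with [B] and contains [i], which [B] does not; so [H] lies above [B]. *)
have mG C' H : C' \subset L_support i F -> chain_of N (C :|: C') -> H \in C' ->
    m \subset val H.
  move=> sC' /and3P[_ /coneP cCC' /forall_inP fCC'] HC'.
  have iH : i \in val H by have := subsetP sC' H HC'; rewrite inE => /andP[].
  apply: mclosure_min; first by apply: fCC'; rewrite inE HC' orbT.
  rewrite subUset sub1set iH; case: BC => [->|[G GC GB]]; first exact: sub0set.
  have := cCC' G H; rewrite !inE GC HC' orbT GB => /(_ isT isT)/orP[//|].
  by move=> /subsetP/(_ i iH); rewrite (negbTE iB).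
(* [m] has rank [(N B).+1], so it contains [F] exactly when [F] raises the rank of [B] by one only;
   this is the condition in [flat_trunc]. *)
have Fm : (F \subset m) = (N (B :|: F) == (N B).+1).
  rewrite sub_mclosureE (rk_flat_add1 fB iB) -setUA.
  by rewrite (setUidPr (_ : [set i] \subset B :|: F)) // sub1set inE iF orbT.
have BF : ((N B).+1 <= N (B :|: F))%N.
  by rewrite -(rk_flat_add1 fB iB) rk_mono // subUset subsetUl sub1set inE iF orbT.
have [Fsm|nFm] := boolP (F \subset m).
- have -> : chain_of (trunc N F) C = false.
    rewrite Fm in Fsm; apply/negP => /and3P[t0 _ /forall_inP tC].
    have : flat (trunc N F) B by case: BC => [->//|[G GC <-]]; apply: tC.
    by rewrite flat_trunc // (negbTE FB) (eqP Fsm) ltnn andbF.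
  move=> C' sC' /set0Pn[H HC']; apply/negP => aC.
  have := subsetP sC' H HC'; rewrite inE => /andP[_ /negP[]].
  exact: subset_trans (mG C' H sC' aC HC').
- have lt : ((N B).+1 < N (B :|: F))%N by rewrite ltn_neqAle eq_sym -Fm nFm.
  (* By diminishing returns, a gap of at least two at [B] persists at every flat below [B]. *)
  have fT A : A \subset B -> flat N A -> flat (trunc N F) A.
    move=> AB fA; rewrite flat_trunc // fA /=; apply/orP; right.
    by have := rk_marginal N F AB; move: lt; clear; lia.
  have -> : chain_of (trunc N F) C.
    apply/and3P; split=> //; first by apply: fT (sub0set _) N0.
    apply/forall_inP => G GC; have := hB G GC; case: ifP => [FG _|_ GB].
      by rewrite flat_trunc // FG fC.
    by apply: fT => //; apply: fC.
  have pm : [&& flat M m, m != set0 & m != [set: E]].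
    rewrite NM //=; apply/andP; split; first by apply/set0Pn; exists i.
    by apply: contraNneq nFm => ->; apply: subsetT.
  exists (Sub m pm : proper_flat M); first by rewrite inE SubK im.
  move=> C' sC' aC; have /and3P[_ /coneP cCC' /forall_inP fCC'] := aC.
  have cmp H : H \in C :|: C' -> (m \subset val H) || (val H \subset m).
    rewrite inE => /orP[HC|HC']; last by rewrite (mG C').
    have := hB H HC; case: ifP => [FH BH|_ HB].
      by rewrite mclosure_min ?fC // subUset sub1set (subsetP FH).
    by rewrite (subset_trans HB Bm) orbT.
  apply/and3P; split=> //.
    apply/coneP => G H /setU1P[->|GC] /setU1P[->|HC]; rewrite ?SubK ?subxx ?cmp //.
      by rewrite orbC cmp.
    exact: cCC'.
  by apply/forall_inP => G /setU1P[->|]; rewrite ?SubK //; apply: fCC'.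
Qed.

(** Ranks are distinct along the chain and lie strictly between 0 and [N [set: E]]. *)
Lemma chain_of_card N C : C != set0 -> chain_of N C -> (#|C| < N [set: E])%N.
Proof.
move=> /set0Pn[G0 G0C] /and3P[N0 /coneP cC /forall_inP fC].
have lt G : G \in C -> (N (val G) < N [set: E])%N.
  move=> GC; apply: rk_flat_proper; first exact: fC.
  by rewrite properT; have /and3P[] := valP G.
have gt G : G \in C -> (0 < N (val G))%N.
  move=> GC; rewrite -{1}(rk_set0 N) rk_flat_proper //.
  by rewrite properEneq eq_sym sub0set andbT; have /and3P[] := valP G.
have inj : {in C &, injective (fun G => N (val G))}.
  move=> G H GC HC /= eN; apply/val_inj/eqP; apply: contraT => neq.
  have /orP[] := cC G H GC HC => s.
    by have := @rk_flat_proper _ N (val G) (val H) (fC _ GC);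
      rewrite properEneq neq s eN ltnn => /(_ isT).
  by have := @rk_flat_proper _ N (val H) (val G) (fC _ HC);
    rewrite properEneq eq_sym neq s eN ltnn => /(_ isT).
have := lt G0 G0C; case eR : (N [set: E]) => [//|r] _; rewrite ltnS.
pose f G : 'I_r.+1 := inord (N (val G)).
have fE G : G \in C -> f G = N (val G) :> nat.
  by move=> GC; rewrite inordK // -eR lt.
have -> : #|C| = #|f @: C|.
  rewrite card_in_imset // => G H GC HC /(congr1 val) /=.
  by rewrite !fE //; apply: inj.
have : f @: C \subset [set~ ord0].
  apply/subsetP => _ /imsetP[G GC ->]; rewrite !inE -val_eqE /= fE //.
  by rewrite -lt0n gt.
by move/subset_leq_card; rewrite cardsC1 card_ord.
Qed.

End Chains.

(** * The K-ring and the Chow ring *)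

Lemma prod_1B (R : comNzRingType) (I : finType) (S : {set I}) (f : I -> R) :
  \prod_(G in S) (1 - f G) =
    \sum_(J : {set I} | J \subset S) (-1) ^+ #|J| * \prod_(G in J) f G.
Proof.
rewrite big_mkcond.
transitivity (\prod_G ((if G \in S then - f G else 0) + 1)).
  by apply: eq_bigr => G _; case: ifP; rewrite ?add0r // addrC.
rewrite bigA_distr [RHS]big_mkcond; apply: eq_bigr => J _ /=.
rewrite -big_mkcond -prodrN; case: ifPn => [/subsetP JS|/subsetPn[G GJ GS]].
  by apply: eq_bigr => G /JS->.
by rewrite (bigD1 G) //= (negbTE GS) mul0r.
Qed.

Section Strata.
Variables (E : finType) (M : matroid E) (R : comNzRingType).
Variable xi : proper_flat M -> R.
Implicit Types (C : {set proper_flat M}).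

(** The class of the intersection of the divisors in [C]. The ring and [xi] are abstract so as to
    serve for both [K_xi] in the K-ring and [chow_D] in the Chow ring. *)
Definition stratum C : R := \prod_(G in C) xi G.

Lemma stratumU C C' : [disjoint C & C'] ->
  stratum (C :|: C') = stratum C * stratum C'.
Proof. by move=> dC; rewrite /stratum -bigU //; apply: eq_bigl => G; rewrite inE. Qed.

End Strata.

Lemma in_ideal_gen (R : comNzRingType) (gen : R -> Prop) g :
  gen g -> g \in ideal_of gen.
Proof.
move=> hg; apply/asboolP; rewrite -[g]mul1r -[1 * g]addr0.
exact: in_idealD hg (in_ideal0 _).
Qed.

Section Classes.
Variables (E : finType) (M : matroid E).
Implicit Types (G H : proper_flat M) (C : {set proper_flat M}).
Implicit Types (F : nonempty_flat M) (i j : E).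

Lemma K_class_zmod_morphism : zmod_morphism (@K_class E M).
Proof. exact: (raddfB (\pi_(K_ring M)%qT)). Qed.

Lemma K_class_monoid_morphism : monoid_morphism (@K_class E M).
Proof. exact: (rmorphism_monoidP (\pi_(K_ring M)%qT)). Qed.

HB.instance Definition _ :=
  GRing.isZmodMorphism.Build (K_poly M) (K_ring M) (@K_class E M)
    K_class_zmod_morphism.
HB.instance Definition _ :=
  GRing.isMonoidMorphism.Build (K_poly M) (K_ring M) (@K_class E M)
    K_class_monoid_morphism.

Lemma chow_class_zmod_morphism : zmod_morphism (@chow_class E M).
Proof. exact: (raddfB (\pi_(chow_ring M)%qT)). Qed.

Lemma chow_class_monoid_morphism : monoid_morphism (@chow_class E M).
Proof. exact: (rmorphism_monoidP (\pi_(chow_ring M)%qT)). Qed.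

HB.instance Definition _ :=
  GRing.isZmodMorphism.Build (chow_poly M) (chow_ring M) (@chow_class E M)
    chow_class_zmod_morphism.
HB.instance Definition _ :=
  GRing.isMonoidMorphism.Build (chow_poly M) (chow_ring M) (@chow_class E M)
    chow_class_monoid_morphism.

Lemma K_class_rel (p : K_poly M) : K_rel p -> K_class p = 0.
Proof.
move=> hp; have : p \in (@K_ideal E M) by apply: in_ideal_gen.
rewrite -[p in p \in _]subr0 Quotient.idealrBE => /eqP e.
by rewrite -[RHS](rmorph0 (@K_class E M)).
Qed.

Lemma chow_class_rel (p : chow_poly M) : chow_rel p -> chow_class p = 0.
Proof.
move=> hp; have : p \in (@chow_ideal E M) by apply: in_ideal_gen.
rewrite -[p in p \in _]subr0 Quotient.idealrBE => /eqP e.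
by rewrite -[RHS](rmorph0 (@chow_class E M)).
Qed.

Local Notation O_D G := (K_class (K_var G false)).

Lemma K_var_inv G : K_class (K_var G true) * O_D G = 1.
Proof.
apply/eqP; rewrite -subr_eq0 -rmorphM -[X in _ - X](rmorph1 (@K_class E M)).
by rewrite -rmorphB /= K_class_rel //; apply: K_rel_inv.
Qed.

Lemma O_D_unit G : O_D G \is a GRing.unit.
Proof.
apply/unitrP; exists (K_class (K_var G true)).
by split; last rewrite mulrC; apply: K_var_inv.
Qed.

Lemma K_var_true G : K_class (K_var G true) = (O_D G)^-1.
Proof. by rewrite -[LHS](mulrK (O_D_unit G)) K_var_inv mul1r. Qed.

Lemma K_O_unit (D : divisor M) : K_O D \is a GRing.unit.
Proof. by apply: rpred_prod => G _; rewrite unitrXz ?O_D_unit. Qed.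

Lemma K_OD (D D' : divisor M) : K_O (fun G => D G + D' G) = K_O D * K_O D'.
Proof.
by rewrite -big_split; apply: eq_bigr => G _; rewrite exprzDr ?O_D_unit.
Qed.

Lemma K_O_char (m : E -> int) : in_dual_lattice m -> K_O (pairing (M := M) m) = 1.
Proof.
move=> hm; apply/eqP; rewrite -subr_eq0 -[X in _ - X](rmorph1 (@K_class E M)).
rewrite -(K_class_rel (K_rel_char M hm)) rmorphB rmorph_prod.
rewrite (inj_eq (addIr _)); apply/eqP/eq_bigr => G _; rewrite rmorphXn /=.
(* In the relation a negative exponent is carried by the variable for [[O(-D_G)]], the inverse of
   [[O(D_G)]]. *)
case: (ltrP _ 0) => h; last by rewrite -[in LHS](gez0_abs h).
by rewrite K_var_true exprnP exprz_inv lez0_abs ?opprK // ltW.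
Qed.

Definition K_xi G : K_ring M := 1 - K_O (oppD (prime_divisor G)).

Lemma K_xiE G : K_xi G = 1 - (O_D G)^-1.
Proof.
congr (1 - _); rewrite /K_O (bigD1 G) //= big1 => [|H HG].
  by rewrite /oppD /prime_divisor eqxx mulr1 -exprz_inv expr1z.
by rewrite /oppD /prime_divisor (negbTE HG) oppr0 expr0z.
Qed.

Lemma K_stratum_eq0 C : ~~ is_cone C -> stratum K_xi C = 0.
Proof.
move=> nC; rewrite -(K_class_rel (K_rel_SR nC)) rmorph_prod.
by apply: eq_bigr => G _; rewrite K_xiE rmorphB /= rmorph1 K_var_true.
Qed.

Lemma chow_stratum_eq0 C : ~~ is_cone C -> stratum (@chow_D E M) C = 0.
Proof. by move=> nC; rewrite -(chow_class_rel (chow_rel_SR nC)) rmorph_prod. Qed.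

Lemma chow_c1D (D D' : divisor M) : c1 (fun G => D G + D' G) = c1 D + c1 D'.
Proof. by rewrite -big_split; apply: eq_bigr => G _; rewrite mulrzDr. Qed.

Lemma chow_c1_char (m : E -> int) : in_dual_lattice m -> c1 (pairing (M := M) m) = 0.
Proof.
move=> hm; rewrite -(chow_class_rel (chow_rel_lin M hm)) rmorph_sum.
by apply: eq_bigr => G _; rewrite rmorphMz.
Qed.

(** The character whose divisor is the difference of the two representatives of [L_F] computed at
    [i] and at [j]. *)
Definition point_difference i j (e : E) : int := (e == i)%:Z - (e == j)%:Z.

Lemma point_difference_dual i j : in_dual_lattice (point_difference i j).
Proof.
have sum1 k : \sum_e (e == k)%:Z = 1.
  by rewrite (bigD1 k) //= eqxx big1 // => e /negbTE->.
by rewrite /in_dual_lattice sumrB !sum1 subrr.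
Qed.

Lemma pairing_point_difference i j G :
  pairing (point_difference i j) G = (i \in val G)%:Z - (j \in val G)%:Z.
Proof.
rewrite /pairing /point_difference /ray_vector.
under eq_bigr do rewrite mulrBl.
rewrite sumrB; congr (_ - _).
  by rewrite (bigD1 i) //= eqxx mul1r big1 ?addr0 // => e /negbTE->; rewrite mul0r.
by rewrite (bigD1 j) //= eqxx mul1r big1 ?addr0 // => e /negbTE->; rewrite mul0r.
Qed.

Lemma L_divisor_difference F i j : i \in val F -> j \in val F ->
  L_divisor F i =1
    (fun G => L_divisor F j G + pairing (point_difference i j) G).
Proof.
move=> iF jF G; rewrite pairing_point_difference /L_divisor.
have [FG|_] := boolP (_ \subset _); last by rewrite !andbT addrC subrK.
by rewrite !(subsetP FG) // !andbF subrr.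
Qed.

Lemma K_O_L_divisor F i j : i \in val F -> j \in val F ->
  K_O (L_divisor F i) = K_O (L_divisor F j).
Proof.
move=> iF jF; rewrite /K_O.
under eq_bigr do rewrite (L_divisor_difference iF jF).
rewrite -[LHS]/(K_O (fun G => L_divisor F j G + pairing (point_difference i j) G)).
by rewrite K_OD (K_O_char (point_difference_dual i j)) mulr1.
Qed.

Lemma c1_L_divisor F i j : i \in val F -> j \in val F ->
  c1 (L_divisor F i) = c1 (L_divisor F j).
Proof.
move=> iF jF; rewrite /c1.
under eq_bigr do rewrite (L_divisor_difference iF jF).
rewrite -[LHS]/(c1 (fun G => L_divisor F j G + pairing (point_difference i j) G)).
by rewrite chow_c1D (chow_c1_char (point_difference_dual i j)) addr0.
Qed.

Lemma K_O_L_divisor_inv F i :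
  (K_O (L_divisor F i))^-1 = \prod_(G in L_support M i (val F)) (1 - K_xi G).
Proof.
rewrite /K_O -prodrV => [|G _]; last by rewrite unitrXz ?O_D_unit.
rewrite [RHS]big_mkcond; apply: eq_bigr => G _.
rewrite /L_divisor inE K_xiE opprB addrC subrK.
by case: ifP => _; rewrite ?expr1z // expr0z invr1.
Qed.

Lemma c1_L_support F i :
  c1 (L_divisor F i) = \sum_(G in L_support M i (val F)) chow_D G.
Proof.
rewrite [RHS]big_mkcond; apply: eq_bigr => G _.
by rewrite /L_divisor inE; case: ifP => // _; rewrite mulr0z.
Qed.

End Classes.

(** * Iterated truncations and cancellation by toggling *)

Section Step.
Variables (E : finType) (M : matroid E).
Implicit Types (N : matroid E) (G : proper_flat M) (C : {set proper_flat M}).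
Implicit Types (F : nonempty_flat M) (s : seq (nonempty_flat M)).

Lemma flat_truncW N (F A : {set E}) : flat (trunc N F) A -> flat N A.
Proof.
case: (posnP (N F)) => F0; last by rewrite flat_trunc // => /andP[].
by move=> /flatP fA; apply/flatP => x /fA; rewrite /= /trunc_rk F0 /= !subn0.
Qed.

Lemma rk_gt0 N (A : {set E}) : flat N set0 -> A != set0 -> (0 < N A)%N.
Proof.
by move=> N0 An0; rewrite -{1}(rk_set0 N) rk_flat_proper // properEneq eq_sym
  An0 sub0set.
Qed.

Lemma chain_of_truncW N (F : {set E}) C : chain_of (trunc N F) C -> chain_of N C.
Proof.
case/and3P=> /flat_truncW N0 cC /forall_inP fC; apply/and3P; split=> //.
by apply/forall_inP => G GC; apply: (flat_truncW (F := F)); apply: fC.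
Qed.

Definition truncations s : matroid E := foldr (fun F N => trunc N (val F)) M s.

Lemma flat_truncations s A : flat (truncations s) A -> flat M A.
Proof. by elim: s => //= F s IH /flat_truncW. Qed.

Lemma nonempty_flat_neq0 F : val F != set0.
Proof. by have /andP[] := valP F. Qed.

(** If the final matroid has no loops, neither has any earlier one; so each [F] has positive rank
    when it is used, and as [[set: E]] spans it, the total rank drops by exactly one. *)
Lemma rk_truncations s : flat (truncations s) set0 ->
  (truncations s [set: E] + size s = M [set: E])%N.
Proof.
elim: s => [|F s IH] /= sf; first by rewrite addn0.
have sf' := flat_truncW sf; have := rk_gt0 sf' (nonempty_flat_neq0 F).
have EF := rk_mono (truncations s) (subsetT (val F)).
rewrite -(IH sf') /trunc_rk setTU eqxx => F0; rewrite F0 /=.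
by move: EF F0; clear; lia.
Qed.

(** Inserting or removing [m] is a sign-reversing involution, so the sum equals its own negative. *)
Lemma sum_toggle (S : {set proper_flat M}) m (a : {set proper_flat M} -> int) :
    m \in S -> (forall C, C \subset S -> a (m |: C) = a (C :\ m)) ->
  \sum_(C : {set proper_flat M} | C \subset S) (-1) ^+ #|C| * a C = 0.
Proof.
move=> mS ha; pose t C := if m \in C then C :\ m else m |: C.
have tK : involutive t.
  move=> C; rewrite /t; have [mC|mC] := boolP (m \in C).
    by rewrite setD11 setD1K.
  by rewrite setU11 setU1K.
have tS C : (t C \subset S) = (C \subset S).
  rewrite /t; case: ifPn => mC; last by rewrite subUset sub1set mS.
  by rewrite -{2}(setD1K mC) subUset sub1set mS.
suff e : \sum_(C : {set proper_flat M} | C \subset S) (-1) ^+ #|C| * a C =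
  - \sum_(C : {set proper_flat M} | C \subset S) (-1) ^+ #|C| * a C by lia.
rewrite {1}(reindex_inj (inv_inj tK)) -sumrN /=; apply: eq_big => [C|C];
  first exact: tS.
rewrite tS -mulNr => CS; rewrite /t; case: ifPn => mC.
  rewrite -(ha _ CS) [m |: C](setUidPr _) ?sub1set // (cardsD1 m C) mC.
  by rewrite exprS mulN1r opprK.
by rewrite ha // (setDidPl _) ?cardsU1 ?mC ?exprS ?mulN1r // disjoint_sym disjoints1.
Qed.

End Step.

(** * Intersection numbers *)

Section Graded.
Variables (E : finType) (M : matroid E).
Implicit Types (a b : chow_ring M).

Lemma chow_graded0 k : (0 : chow_ring M) \in chow_graded k.
Proof. by apply/asboolP; exists 0; rewrite ?dhomog0 ?rmorph0. Qed.

Lemma chow_gradedD k a b :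
  a \in chow_graded k -> b \in chow_graded k -> a + b \in chow_graded k.
Proof.
move=> /asboolP[p hp ->] /asboolP[q hq ->]; apply/asboolP.
by exists (p + q); rewrite ?rpredD ?rmorphD.
Qed.

Lemma chow_gradedMz k a z : a \in chow_graded k -> a *~ z \in chow_graded k.
Proof.
move=> /asboolP[p hp ->]; apply/asboolP.
by exists (p *~ z); rewrite ?rpredMz ?rmorphMz.
Qed.

Lemma chow_gradedM k l a b : a \in chow_graded k -> b \in chow_graded l ->
  a * b \in chow_graded (k + l).
Proof.
move=> /asboolP[p hp ->] /asboolP[q hq ->]; apply/asboolP.
by exists (p * q); rewrite ?dhomogM ?rmorphM.
Qed.

Lemma chow_graded1 : (1 : chow_ring M) \in chow_graded 0.
Proof. by apply/asboolP; exists 1; rewrite ?dhomog1 ?rmorph1. Qed.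

Lemma chow_graded_D (G : proper_flat M) : chow_D G \in chow_graded 1.
Proof.
by apply/asboolP; exists (chow_var G); rewrite // /chow_var dhomogX /= mdeg1.
Qed.

Lemma chow_graded_sum (I : Type) (r : seq I) (P : pred I) (f : I -> chow_ring M) k :
  (forall i, P i -> f i \in chow_graded k) ->
  \sum_(i <- r | P i) f i \in chow_graded k.
Proof.
by move=> h; elim/big_ind: _ => //; [apply: chow_graded0|apply: chow_gradedD].
Qed.

Lemma chow_graded_prod (I : Type) (r : seq I) (P : pred I) (f : I -> chow_ring M)
    (e : I -> nat) :
  (forall i, P i -> f i \in chow_graded (e i)) ->
  \prod_(i <- r | P i) f i \in chow_graded (\sum_(i <- r | P i) e i).
Proof.
move=> h; elim/big_rec2: _ => [|i a k Pi]; first exact: chow_graded1.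
by apply: chow_gradedM; apply: h.
Qed.

Lemma chow_graded_c1 (D : divisor M) : c1 D \in chow_graded 1.
Proof. by apply: chow_graded_sum => G _; apply/chow_gradedMz/chow_graded_D. Qed.

End Graded.

(** * Euler characteristics of strata times [eta] classes *)

Section Euler.
Variables (E : finType) (M : matroid E) (K : comNzRingType).
Variables (xi : proper_flat M -> K) (eta : nonempty_flat M -> K).
Implicit Types (N : matroid E) (G : proper_flat M) (C : {set proper_flat M}).
Implicit Types (F : nonempty_flat M) (s : seq (nonempty_flat M)).

Hypothesis xi_SR : forall C, ~~ is_cone C -> stratum xi C = 0.
Hypothesis etaE : forall F j, j \in val F ->
  eta F = 1 - \prod_(G in L_support M j (val F)) (1 - xi G).

(** In the expansion of [eta F] the empty subset cancels the 1; the other subsets are disjoint from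
    [C], so each product is again a stratum. *)
Lemma stratum_eta F j C : j \in val F -> avoids j (val F) C ->
  stratum xi C * eta F =
    - \sum_(C' : {set proper_flat M} |
             (C' \subset L_support M j (val F)) && (C' != set0))
        (-1) ^+ #|C'| * stratum xi (C :|: C').
Proof.
move=> jF avC; rewrite (etaE jF) prod_1B.
rewrite (bigD1 set0) ?sub0set //= cards0 expr0 mul1r big_set0 opprD addrA subrr.
rewrite add0r mulrN mulr_sumr; congr (- _); apply: eq_bigr => C' /andP[sC' _].
by rewrite mulrCA stratumU // (L_support_disjoint avC).
Qed.

(* Chains avoiding [j] only get longer, so too many factors leave nothing. *)
Lemma stratum_eta_eq0 s C :
  (#|{: proper_flat M}| < #|C| + size s)%N ->
  stratum xi C * \prod_(F <- s) eta F = 0.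
Proof.
elim: s C => [|F s IH] C lt; first by move: lt; rewrite addn0 ltnNge max_card.
have [cC|nC] := boolP (is_cone C); last by rewrite xi_SR // mul0r.
have [j jF avC] := avoid_cone (nonempty_flat_neq0 F) cC.
rewrite big_cons mulrA (stratum_eta jF avC) mulNr mulr_suml big1 ?oppr0 //.
move=> C' /andP[sC' nC']; rewrite -mulrA IH ?mulr0 //.
apply: leq_trans lt _; rewrite /= addnS -addSn leq_add2r.
have := L_support_disjoint avC sC'; rewrite -leq_card_setU => /eqP->.
by rewrite -addn1 leq_add2l card_gt0.
Qed.

Hypothesis lM : loopless M.
Variable chi : K -> int.
Hypothesis chiD : {morph chi : a b / a + b}.
Hypothesis chi1 : forall C, is_cone C -> chi (stratum xi C) = 1.

(** Induction on [s]: one more [eta F] gives minus the signed count of nonempty extensions [C'] for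
    which [C :|: C'] is a chain of flats of the current truncation. By [chain_of_trunc] either there
    are none, or they can be toggled by a flat [m]. *)
Lemma chi_strata s C :
  chi (stratum xi C * \prod_(F <- s) eta F) = chain_of (truncations s) C.
Proof.
have chi0 : chi 0 = 0 by have := chiD 0 0; rewrite addr0; lia.
have chiN x : chi (- x) = - chi x by have := chiD x (- x); rewrite subrr chi0; lia.
have chi_sum := big_morph chi chiD chi0.
have chiS n x : chi ((-1) ^+ n * x) = (-1) ^+ n * chi x.
  by rewrite -signr_odd -[in RHS]signr_odd; case: (odd n); rewrite ?mul1r ?mulN1r.
elim: s C => [|F s IH] C.
  rewrite big_nil mulr1; case: (boolP (is_cone C)) => cC.
    rewrite chi1 // /chain_of cC /=.
    have -> : flat M set0.
      by apply/flatP => x _; rewrite rk_set0 setU0 lt0n; apply: lM.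
    by case: forall_inP => // -[] G _; have /and3P[] := valP G.
  by rewrite xi_SR // chi0 /chain_of (negbTE cC) andbF.
have [cC|nC] := boolP (is_cone C); last first.
  by rewrite xi_SR // mul0r chi0 /chain_of (negbTE nC) andbF.
have [j jF avC] := avoid_cone (nonempty_flat_neq0 F) cC.
rewrite big_cons mulrA (stratum_eta jF avC) mulNr mulr_suml chiN chi_sum /=.
set N := truncations s; set S := L_support M j (val F).
under eq_bigr => C' _ do rewrite -mulrA chiS IH -/N.
have [aC|naC] := boolP (chain_of N C); last first.
  have -> : chain_of (trunc N (val F)) C = false.
    by apply: contraNF naC; apply: chain_of_truncW.
  rewrite big1 ?oppr0 // => C' _.
  have -> : chain_of N (C :|: C') = false; last by rewrite mulr0.
  by apply: contraNF naC; apply: chain_ofS (subsetUl _ _).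
have := chain_of_trunc (@flat_truncations _ _ s) jF avC aC; rewrite -/N -/S.
case: ifP => _ => [[m mS hm]|h]; last first.
  by rewrite big1 ?oppr0 // => C' /andP[C'S nC'];
    rewrite (negbTE (h _ C'S nC')) mulr0.
(* The sum over all [C'] vanishes and its empty term is 1, so the nonempty ones contribute -1. *)
have := sum_toggle (a := fun C' => chain_of N (C :|: C')) mS.
rewrite (bigD1 set0) ?sub0set //= cards0 setU0 aC mulr1.
move=> e; apply/eqP; rewrite eq_sym -subr_eq0 opprK e // => C' C'S.
have sC : C' :\ m \subset S by rewrite (subset_trans (subsetDl _ _)).
(* Toggle invariance: [hm] inserts [m], and passing to a subchain removes it. *)
have -> : m |: C' = m |: (C' :\ m).
  by apply/setP => G; rewrite !inE; case: (G =P m).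
congr (nat_of_bool _)%:Z; apply/idP/idP => [|/(hm _ sC)]; last by rewrite setUCA.
by apply: chain_ofS; rewrite setUS ?subsetUr.
Qed.

End Euler.

(** * Degrees of strata times divisor classes *)

Section Degree.
Variables (A : comNzRingType) (gr : {pred A}) (deg : A -> int).
Hypothesis gr0 : 0 \in gr.
Hypothesis grD : {in gr &, forall a b, a + b \in gr}.
Hypothesis degD : {in gr &, {morph deg : a b / a + b}}.

Lemma deg0 : deg 0 = 0.
Proof. by have := degD gr0 gr0; rewrite addr0; lia. Qed.

Lemma deg_sum (I : Type) (r : seq I) (P : pred I) (f : I -> A) :
  (forall i, P i -> f i \in gr) ->
  deg (\sum_(i <- r | P i) f i) = \sum_(i <- r | P i) deg (f i).
Proof.
(* Additivity is available only inside [gr], so membership is carried along with the value. *)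
move=> h; pose K a z := a \in gr /\ deg a = z.
suff [] : K (\sum_(i <- r | P i) f i) (\sum_(i <- r | P i) deg (f i)) by [].
apply: (big_ind2 K) => [|a z b w [ha <-] [hb <-]|i Pi].
- by split=> //; apply: deg0.
- by split; [apply: grD|apply: degD].
- by split=> //; apply: h.
Qed.

Hypothesis grN : {in gr, forall a, - a \in gr}.

Lemma grMz a z : a \in gr -> a *~ z \in gr.
Proof.
move=> ha; have grn n : a *+ n \in gr.
  by elim: n => [|n IH]; rewrite ?mulr0n // mulrS grD.
by case: z => n; [exact: grn | rewrite NegzE mulrNz grN ?grn].
Qed.

Lemma degMz a z : a \in gr -> deg (a *~ z) = deg a * z.
Proof.
move=> ha; have dN n : deg (a *~ n%:Z) = deg a * n%:Z.
  elim: n => [|n IH]; first by rewrite mulr0z deg0 mulr0.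
  by rewrite intS mulrzDr mulrDr mulr1 -IH degD ?grMz.
case: z => n; first exact: dN.
rewrite NegzE; have := degD (grMz n.+1 ha) (grMz (- n.+1%:Z) ha).
rewrite -mulrzDr subrr mulr0z deg0 dN mulrN => /esym/eqP.
by rewrite addrC addr_eq0 => /eqP.
Qed.

Variables (E : finType) (M : matroid E).
Variables (x : proper_flat M -> A) (c : nonempty_flat M -> A).
Implicit Types (N : matroid E) (G : proper_flat M) (C : {set proper_flat M}).
Implicit Types (F : nonempty_flat M) (s : seq (nonempty_flat M)).

Hypothesis lM : loopless M.
Hypothesis x_SR : forall C, ~~ is_cone C -> stratum x C = 0.
Hypothesis cE : forall F j, j \in val F ->
  c F = \sum_(G in L_support M j (val F)) x G.
Hypothesis gr_stratum : forall C s, (#|C| + size s = fan_dim M)%N ->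
  stratum x C * \prod_(F <- s) c F \in gr.
Hypothesis deg1 : forall C, is_cone C -> #|C| = fan_dim M -> deg (stratum x C) = 1.

Lemma stratum_c F j C : j \in val F -> avoids j (val F) C ->
  stratum x C * c F = \sum_(G in L_support M j (val F)) stratum x (G |: C).
Proof.
move=> jF avC; rewrite (cE jF) mulr_sumr; apply: eq_bigr => G GS.
rewrite setUC stratumU; first by rewrite [stratum x [set G]]big_set1.
by apply: L_support_disjoint avC _; rewrite sub1set.
Qed.

(** The induction of [chi_strata] with single flats [G] in place of sets [C']. When [C] survives
    truncation, the flat [m] is the only one that extends it, because the extended chain is already
    as long as the rank allows. *)
Lemma deg_strata s C : (#|C| + size s = fan_dim M)%N ->
  deg (stratum x C * \prod_(F <- s) c F) = chain_of (truncations s) C.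
Proof.
elim: s C => [|F s IH] C /= dC.
  rewrite big_nil mulr1; have [cC|nC] := boolP (is_cone C).
    rewrite deg1 -?dC ?addn0 // /chain_of cC.
    have -> : flat M set0.
      by apply/flatP => y _; rewrite rk_set0 setU0 lt0n; apply: lM.
    by case: forall_inP => // -[] G _; have /and3P[] := valP G.
  by rewrite x_SR // deg0 /chain_of (negbTE nC) andbF.
have [cC|nC] := boolP (is_cone C); last first.
  by rewrite x_SR // mul0r deg0 /chain_of (negbTE nC) andbF.
have [j jF avC] := avoid_cone (nonempty_flat_neq0 F) cC.
have dGC G : G \in L_support M j (val F) -> (#|G |: C| + size s)%N = fan_dim M.
  move=> GS; have := L_support_disjoint avC (C' := [set G]).
  by rewrite sub1set disjoint_sym disjoints1 -dC cardsU1 addnS => /(_ GS) ->.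
rewrite big_cons mulrA (stratum_c jF avC) mulr_suml deg_sum => [|G GS]; last first.
  exact: gr_stratum (dGC G GS).
set N := truncations s; set S := L_support M j (val F).
rewrite (eq_bigr (fun G => (chain_of N (G |: C))%:Z)) => [|G GS]; last exact/IH/dGC.
have [aC|naC] := boolP (chain_of N C); last first.
  have -> : chain_of (trunc N (val F)) C = false.
    by apply: contraNF naC; apply: chain_of_truncW.
  rewrite big1 // => G _.
  have -> // : chain_of N (G |: C) = false.
  by apply: contraNF naC; apply: chain_ofS (subsetUr _ _).
have := chain_of_trunc (@flat_truncations _ _ s) jF avC aC; rewrite -/N -/S.
case: ifP => _ => [[m mS hm]|h]; last first.
  rewrite big1 // => G GS; have := h [set G]; rewrite sub1set => /(_ GS).
  by rewrite setUC => /(_ _)/negbTE -> //; apply/set0Pn; exists G; rewrite inE.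
have hmG G : G \in S -> chain_of N (G |: C) -> chain_of N (m |: (G |: C)).
  by move=> GS; rewrite [G |: C]setUC; apply: hm; rewrite sub1set.
rewrite (bigD1 m) //=.
have -> : chain_of N (m |: C).
  by have := hm set0 (sub0set _); rewrite setU0; apply.
(* A second term would produce a chain longer than a maximal one. *)
rewrite big1 ?addr0 // => G /andP[GS Gm].
have -> // : chain_of N (G |: C) = false.
apply/negP => /(hmG G GS) aG; have := chain_of_card _ aG.
have N0 : flat N set0 by case/and3P: aC.
have := rk_truncations N0; have := dGC G GS; have := dGC m mS; rewrite /fan_dim.
have [mGC|mGC] := boolP (m \in G |: C).
  move: mGC; rewrite !inE eq_sym (negbTE Gm) /= => mC.
  have := L_support_disjoint avC (C' := [set m]).
  by rewrite sub1set disjoint_sym disjoints1 mC => /(_ mS).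
rewrite [#|m |: (G |: C)|]cardsU1 mGC -/N => _ e1 e2.
have -> : (m |: (G |: C) != set0) by apply/set0Pn; exists m; rewrite setU11.
move=> /(_ isT) /=; move: e1 e2; clear.
by move: #|G |: C| (N [set: E]) (M [set: E]) => a b e; lia.
Qed.

End Degree.

(** * The Pochhammer transform *)

Definition rising (R : pzRingType) (x : R) (k : nat) : R := \prod_(j < k) (x + j%:R).

(** Backward difference acts on rising factorials as the derivative does on powers. For [k = 0] the
    coefficient vanishes, so the truncated predecessor is harmless. *)
Lemma rising_diff (R : comPzRingType) (x : R) k :
  rising x k - rising (x - 1) k = k%:R * rising x k.-1.
Proof.
case: k => [|k]; first by rewrite /rising !big_ord0 subrr mul0r.
have -> : rising (x - 1) k.+1 = (x - 1) * rising x k.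
  rewrite /rising big_ord_recl addr0; congr (_ * _).
  by apply: eq_bigr => j _; rewrite lift0 -natr1; ring.
have -> : rising x k.+1 = rising x k * (x + k%:R) by rewrite /rising big_ord_recr.
rewrite -natr1 /=; ring.
Qed.

Section Pochhammer.
Variable n : nat.
Implicit Types (p q : {mpoly rat[n]}) (t : 'I_n -> rat) (m : 'X_{1..n}).

Definition rising_mnm t m : rat := \prod_k rising (t k) (m k).

(** The value at [t] of the Pochhammer transform of [p]; see [meval_Poch_up]. *)
Definition Poch_eval t p : rat := \sum_(m <- msupp p) p@_m * rising_mnm t m.

(** A range of monomials independent of the support of [p], from which linearity follows
    termwise. *)
Lemma Poch_evalwE t p w : (msize p <= w)%N ->
  Poch_eval t p = \sum_(m : 'X_{1..n < w}) p@_m * rising_mnm t m.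
Proof.
move=> pw; pose I : subFinType _ := 'X_{1..n < w}.
rewrite /Poch_eval (big_mksub I) //=; first last.
- by move=> m /msize_mdeg_lt /leq_trans; apply.
- by rewrite msupp_uniq.
by rewrite big_rmcond //= => m /memN_msupp_eq0 ->; rewrite mul0r.
Qed.

Lemma Poch_evalD t p q : Poch_eval t (p + q) = Poch_eval t p + Poch_eval t q.
Proof.
pose w := maxn (msize (p + q)) (maxn (msize p) (msize q)).
rewrite !(@Poch_evalwE _ _ w) /w ?leq_max ?leqnn ?orbT // -big_split.
by apply: eq_bigr => m _; rewrite mcoeffD mulrDl.
Qed.

Lemma Poch_evalZ t a p : Poch_eval t (a *: p) = a * Poch_eval t p.
Proof.
pose w := maxn (msize (a *: p)) (msize p).
rewrite !(@Poch_evalwE _ _ w) /w ?leq_max ?leqnn ?orbT // mulr_sumr.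
by apply: eq_bigr => m _; rewrite mcoeffZ mulrA.
Qed.

Lemma Poch_eval0 t : Poch_eval t 0 = 0.
Proof. by rewrite /Poch_eval msupp0 big_nil. Qed.

Lemma Poch_evalX t m : Poch_eval t 'X_[m] = rising_mnm t m.
Proof. by rewrite /Poch_eval msuppX big_seq1 mcoeffX eqxx mul1r. Qed.

Lemma rising_mnm_diff t m k :
  rising_mnm t m - rising_mnm (fun l => t l - (l == k)%:R) m =
    (m k)%:R * rising_mnm t (m - U_(k))%MM.
Proof.
rewrite /rising_mnm !(bigD1 (P := predT) k) //= eqxx.
set P := \prod_(l < n | l != k) rising (t l) (m l).
have -> : \prod_(l < n | l != k) rising (t l - (l == k)%:R) (m l) = P.
  by apply: eq_bigr => l /negbTE->; rewrite subr0.
have -> : \prod_(l < n | l != k) rising (t l) ((m - U_(k))%MM l) = P.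
  by apply: eq_bigr => l lk; rewrite mnmBE mnm1E eq_sym (negbTE lk) subn0.
by rewrite mnmBE mnm1E eqxx subn1 -mulrBl rising_diff mulrA.
Qed.

Lemma Poch_eval_diff t p k :
  Poch_eval t p - Poch_eval (fun l => t l - (l == k)%:R) p = Poch_eval t p^`M(k).
Proof.
elim/mpolyind: p => [|a m p _ _ IH]; first by rewrite mderiv0 !Poch_eval0 subrr.
rewrite mderivD mderivZ mderivX !Poch_evalD !Poch_evalZ !Poch_evalX.
rewrite opprD addrACA IH -mulrBr rising_mnm_diff mulrA; congr (_ + _).
Qed.

(** A rising factorial of positive length has its argument as first factor, so only the constant
    term survives. *)
Lemma Poch_eval_at0 t p : t =1 (fun=> 0) -> Poch_eval t p = p@_0.
Proof.
move=> t0; elim/mpolyind: p => [|a m p _ _ IH]; first by rewrite Poch_eval0 mcoeff0.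
rewrite Poch_evalD Poch_evalZ Poch_evalX IH mcoeffD mcoeffZ mcoeffX.
congr (_ * _ + _); have [->|m0] := eqVneq m 0%MM.
  by rewrite /rising_mnm big1 // => k _; rewrite mnm0E /rising big_ord0.
have [k mk] : exists k, m k != 0%N.
  apply/existsP; apply: contraT; rewrite negb_exists => /forallP h.
  case/negP: m0; apply/eqP/mnmP => k; rewrite mnm0E.
  by have := h k; rewrite negbK => /eqP.
rewrite /rising_mnm (bigD1 k) //= /rising; case: (m k) mk => // a' _.
by rewrite big_ord_recl t0 addr0 !mul0r.
Qed.

End Pochhammer.

(** * Multinomial coefficients *)

Section Multinomial.
Variable n : nat.
Local Notation S := (\sum_k 'X_k : {mpoly int[n]}).

(** The multinomial formula with denominators cleared. Induction on [d]: compare coefficients after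
    differentiating in a variable that occurs in [m]. *)
Lemma mcoeff_exp_sumX d (m : 'X_{1..n}) : mdeg m = d ->
  (S ^+ d)@_m * (\prod_k (m k)`!)%:R = d`!%:R.
Proof.
elim: d m => [|d IH] m md.
  have -> : m = 0%MM by apply/eqP; rewrite -mdeg_eq0 md.
  by rewrite expr0 mcoeff1 eqxx big1 // => k _; rewrite mnm0E.
have dS k e : mderiv k (S ^+ e.+1) = S ^+ e *+ e.+1.
  have dS1 : mderiv k S = 1.
    rewrite linear_sum (bigD1 k) //= mderivX mnm1E eqxx scale1r big1 ?addr0.
      suff -> : (U_(k) - U_(k) = 0 :> 'X_{1..n})%MM by rewrite mpolyX0.
      by apply/mnmP => l; rewrite mnmBE subnn mnm0E.
    by move=> l lk; rewrite mderivX mnm1E (negbTE lk) scale0r.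
  elim: e => [|e IHe]; first by rewrite expr1 expr0 mulr1n dS1.
  by rewrite exprS mderivM dS1 mul1r IHe mulrnAr -exprS [RHS]mulrS.
have [k mk] : exists k, m k != 0%N.
  apply/existsP; apply: contraT; rewrite negb_exists => /forallP h.
  have m0 : m = 0%MM.
    by apply/mnmP => k; rewrite mnm0E; have := h k; rewrite negbK => /eqP.
  by move: md; rewrite m0 mdeg0.
have em : m = (m - U_(k) + U_(k))%MM.
  by rewrite submK //; apply/mnm_lepP => l; rewrite mnm1E; case: eqP => // <-;
    rewrite lt0n.
have md' : mdeg (m - U_(k))%MM = d by move: md; rewrite em mdegD mdeg1 -em; lia.
have := congr1 (fun p => p@_(m - U_(k))) (dS k d).
rewrite mcoeff_deriv -em mcoeffMn -[in LHS]mulr_natr -[in RHS]mulr_natr => e.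
have -> : (\prod_l (m l)`! =
    ((m - U_(k))%MM k).+1 * \prod_l ((m - U_(k))%MM l)`!)%N.
  rewrite [LHS](bigD1 k) //= [in RHS](bigD1 k) //= mulnA -factS mnmBE mnm1E
    eqxx subn1.
  rewrite prednK ?lt0n //; congr (_ * _)%N; apply: eq_bigr => l lk.
  by rewrite mnmBE mnm1E eq_sym (negbTE lk) subn0.
by rewrite natrM mulrA e mulrAC IH // factS mulnC natrM.
Qed.

Lemma exp_sumX_homog d : S ^+ d \is d.-homog.
Proof.
rewrite -[X in X.-homog]mul1n; apply: dhomogMn; apply: rpred_sum => k _.
by rewrite dhomogX /= mdeg1.
Qed.

(** The expansion in integer polynomials, specialized by sending ['X_k] to [a k]. *)
Lemma exp_sum_mcoeff (A : comNzRingType) (a : 'I_n -> A) d :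
  (\sum_k a k) ^+ d =
    \sum_(m : 'X_{1..n < d.+1}) (\prod_k a k ^+ m k) *~ (S ^+ d)@_m.
Proof.
have -> : (\sum_k a k) ^+ d = mmap intr a (S ^+ d).
  rewrite rmorphXn rmorph_sum; congr (_ ^+ d); apply: eq_bigr => k _ /=.
  by rewrite mmapX mmap1U.
rewrite (@mmapE _ _ _ _ _ _ d.+1).
  by apply: eq_bigr => m _; rewrite mulrzl.
rewrite msizeE; apply/bigmax_leqP_seq => m mS _.
by rewrite (dhomog_mf (exp_sumX_homog d)).
Qed.

End Multinomial.

(** * Comparison of the difference equations *)

(** Unit steps, taken in both directions, join any two integer vectors; [u r] is [t] with the
    coordinates listed in [r] already moved to [t']. *)
Lemma shift_invariant_const (I : finType) (V : Type) (H : (I -> int) -> V) :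
    (forall t x, H (fun y => t y - (y == x)%:Z) = H t) ->
  forall t t', H t = H t'.
Proof.
move=> Hs.
have Hn t x k : H (fun y => t y - (y == x)%:Z * k%:Z) = H t.
  elim: k => [|k IH]; first by congr H; apply/funext => y; rewrite mulr0 subr0.
  rewrite -[RHS]IH -[RHS](Hs _ x); congr H; apply/funext => y; case: (y == x); lia.
have Hz t x z : H (fun y => t y + (y == x)%:Z * z) = H t.
  case: z => k; last by rewrite -[RHS](Hn _ x k.+1); congr H;
    apply/funext => y; case: (y == x); lia.
  by rewrite -(Hn _ x k); congr H; apply/funext => y; case: (y == x); lia.
move=> t t'; pose u (r : seq I) y := if y \in r then t' y else t y.
have Hu r : H (u r) = H t.
  elim: r => [|x r IH]; first by congr H; apply/funext.
  rewrite -IH -(Hz (u r) x (t' x - u r x)); congr H; apply/funext => y.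
  rewrite /u inE; have [->|yx] := eqVneq y x; last by rewrite mul0r addr0.
  by rewrite mul1r addrC subrK.
by rewrite -(Hu (enum I)); congr H; apply/funext => y; rewrite /u mem_enum.
Qed.

Section Main.
Variables (E : finType) (M : matroid E).
Implicit Types (N : matroid E) (G : proper_flat M) (C : {set proper_flat M}).
Implicit Types (F : nonempty_flat M) (s : seq (nonempty_flat M)) (t : Lambda M).
Hypothesis lM : loopless M.

Variables (A : comNzRingType) (gr : {pred A}) (deg : A -> int).
Hypothesis gr0 : 0 \in gr.
Hypothesis grD : {in gr &, forall a b, a + b \in gr}.
Hypothesis grN : {in gr, forall a, - a \in gr}.
Hypothesis degD : {in gr &, {morph deg : a b / a + b}}.
Variables (x : proper_flat M -> A) (c : nonempty_flat M -> A).
Hypothesis x_SR : forall C, ~~ is_cone C -> stratum x C = 0.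
Hypothesis cE : forall F j, j \in val F ->
  c F = \sum_(G in L_support M j (val F)) x G.
Hypothesis gr_stratum : forall C s, (#|C| + size s = fan_dim M)%N ->
  stratum x C * \prod_(F <- s) c F \in gr.
Hypothesis deg1 : forall C, is_cone C -> #|C| = fan_dim M -> deg (stratum x C) = 1.

Variables (K : comUnitRingType) (chi : K -> int).
Hypothesis chiD : {morph chi : a b / a + b}.
Variables (xi : proper_flat M -> K) (ell : nonempty_flat M -> K).
Hypothesis xi_SR : forall C, ~~ is_cone C -> stratum xi C = 0.
Hypothesis ell_unit : forall F, ell F \is a GRing.unit.
Hypothesis ellE : forall F j, j \in val F ->
  (ell F)^-1 = \prod_(G in L_support M j (val F)) (1 - xi G).
Hypothesis chi1 : forall C, is_cone C -> chi (stratum xi C) = 1.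

Local Notation d := (fan_dim M).
Local Notation n := #|{: nonempty_flat M}|.
Local Notation eta := (fun F => 1 - (ell F)^-1).

Let etaE F j : j \in val F ->
  eta F = 1 - \prod_(G in L_support M j (val F)) (1 - xi G).
Proof. by move=> jF; rewrite -(ellE jF). Qed.

Definition c_mnm (m : 'X_{1..n}) : A := \prod_k c (enum_val k) ^+ m k.

(** Coefficients of the iterated partial derivative of the volume polynomial along the members of
    [s]; the test keeps [deg] to products of degree [d]. *)
Definition vol_coef s (m : 'X_{1..n}) : rat :=
  if (size s + mdeg m == d)%N
  then (deg (\prod_(F <- s) c F * c_mnm m))%:~R / (\prod_k (m k)`!)%:R else 0.

Definition vol s : Lambda_poly M :=
  \sum_(m : 'X_{1..n < d.+1}) vol_coef s m *: 'X_[m].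

Lemma mcoeff_vol s m : (vol s)@_m = vol_coef s m.
Proof.
have [lt|ge] := ltnP (mdeg m) d.+1; first exact: (mcoeff_mpoly (vol_coef s)).
rewrite /vol raddf_sum big1 => [|m' _].
  rewrite /vol_coef; case: eqP => // e; move: ge; rewrite -e; lia.
rewrite /= mcoeffZ mcoeffX; case: eqP => [e|_]; last by rewrite mulr0.
by move: ge; rewrite -e leqNgt (bmdeg m').
Qed.

Lemma mderiv_vol s k : (vol s)^`M(k) = vol (enum_val k :: s).
Proof.
apply/mpolyP => m; rewrite mcoeff_deriv !mcoeff_vol /vol_coef mdegD mdeg1 /=.
rewrite addn1 addnS -addSn; case: eqP => _; last by rewrite mul0rn.
have -> : c_mnm (m + U_(k)) = c (enum_val k) * c_mnm m.
  rewrite /c_mnm (bigD1 k) // [in RHS](bigD1 k) //= mulrA -exprS mnmDE mnm1E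
    eqxx addn1.
  congr (_ * _); apply: eq_bigr => l lk.
  by rewrite mnmDE mnm1E eq_sym (negbTE lk) addn0.
have -> : (\prod_l ((m + U_(k))%MM l)`! = (m k).+1 * \prod_l (m l)`!)%N.
  rewrite (bigD1 k) // [in RHS](bigD1 k) //= mulnA -factS mnmDE mnm1E eqxx addn1.
  congr (_ * _)%N; apply: eq_bigr => l lk.
  by rewrite mnmDE mnm1E eq_sym (negbTE lk) addn0.
rewrite big_cons -mulrA [c _ * (_ * _)]mulrCA natrM invfM.
rewrite [X in X *+ _]mulrC -mulrnAl -mulrnAl -[X in X * _ * _]mulr_natr.
by rewrite mulVf ?mul1r 1?mulrC // pnatr_eq0.
Qed.

Lemma flat_setT N : flat N [set: E].
Proof. by apply/flatP => y; rewrite inE. Qed.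

Let chi_prod s : chi (\prod_(F <- s) eta F) = flat (truncations s) set0.
Proof.
by rewrite -(chain_of_set0 M) -(chi_strata xi_SR etaE lM chiD chi1) /stratum
  big_set0 mul1r.
Qed.

Let deg_prod s : size s = d -> deg (\prod_(F <- s) c F) = flat (truncations s) set0.
Proof.
move=> sd; rewrite -(chain_of_set0 M) -(deg_strata gr0 grD degD lM x_SR cE
  gr_stratum deg1).
  by rewrite /stratum big_set0 mul1r.
by rewrite cards0.
Qed.

Let chiB a b : chi (a - b) = chi a - chi b.
Proof. by have := chiD (a - b) b; rewrite subrK; lia. Qed.

(* At [- u_E] only the line bundle [L_E^-1 = 1 - eta_E] survives, and
   multiplying by [eta_E] truncates the matroid, killing only rank one. *)
Lemma chi_at_minus_uE s :
  chi (\prod_(F <- s) eta F * \prod_F ell F ^ (- basis_vec M [set: E] F)) =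
    if size s == d then deg (\prod_(F <- s) c F) else 0.
Proof.
transitivity (if size s == d then (flat (truncations s) set0)%:Z else 0); last first.
  by case: eqP => // /deg_prod->.
(* With [E] empty there are no nonempty flats, so [s] is empty, and [d] is 0 as a truncated
   predecessor. *)
have [E0|E0] := eqVneq [set: E] set0.
  have noF F : False.
    by have := subsetT (val F); rewrite E0 subset0 (negbTE (nonempty_flat_neq0 F)).
  case: s => [|F]; last by case: (noF F).
  rewrite [\prod_F _]big1 => [|F]; last by case: (noF F).
  by rewrite mulr1 chi_prod /fan_dim E0 rk_set0.
have pE : flat M [set: E] && ([set: E] != set0) by rewrite flat_setT.
pose F0 : nonempty_flat M := Sub [set: E] pE.
have -> : \prod_F ell F ^ (- basis_vec M [set: E] F) = 1 - eta F0.
  rewrite opprB addrC subrK (bigD1 F0) //= big1 => [|F FF0].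
    by rewrite /basis_vec SubK eqxx mulr1.
  by rewrite /basis_vec -(inj_eq val_inj) /= in FF0 *; rewrite (negbTE FF0).
rewrite mulrBr mulr1 chiB.
have -> : \prod_(F <- s) eta F * eta F0 = \prod_(F <- F0 :: s) eta F.
  by rewrite big_cons mulrC.
rewrite !chi_prod /=.
set N := truncations s; case N0 : (flat N set0); last first.
  by case e: (flat _ _); [move/flat_truncW: e; rewrite N0|case: ifP].
(* The truncation of [N] along [E] acquires loops exactly when [N [set: E]] is 1, that is, when
   [size s] is [d]. *)
have rN := rk_truncations N0; have NE := rk_gt0 N0 E0.
rewrite -/N in rN; rewrite flat_trunc ?SubK // N0 subset0 (negbTE E0) /= set0U
  rk_set0.
rewrite /fan_dim -rN.
by move: (N [set: E]) NE => a; clear; case: eqP; lia.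
Qed.

(** Descending induction on the length of [s]. The case of [F :: s] says that both sides for [s]
    have equal backward differences along [u_F]; so they differ by a constant, which is zero by
    evaluation at [- u_E], where the arguments of [Poch_eval] are all 0. *)
Lemma snap_poch_vol s t :
  (chi (\prod_(F <- s) eta F * \prod_F ell F ^ t F))%:~R =
    Poch_eval
      (fun k => (t (enum_val k) + basis_vec M [set: E] (enum_val k))%:~R)
      (vol s).
Proof.
pose snap s' t' : rat := (chi (\prod_(F <- s') eta F * \prod_F ell F ^ t' F))%:~R.
pose vol_at s' t' := Poch_eval
  (fun k => (t' (enum_val k) + basis_vec M [set: E] (enum_val k))%:~R) (vol s').
have snap_diff s' t' F :
    snap s' t' - snap s' (fun y => t' y - (y == F)%:Z) = snap (F :: s') t'.
  rewrite /snap -intrB -chiB; congr (chi _)%:~R; rewrite big_cons.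
  have -> : \prod_y ell y ^ (t' y - (y == F)%:Z) = \prod_y ell y ^ t' y * (ell F)^-1.
    rewrite (bigD1 F) //= [in RHS](bigD1 F) //= eqxx exprzDr // -!mulrA;
      congr (_ * _).
    rewrite mulrC; congr (_ * _); apply: eq_bigr => y /negbTE->.
    by rewrite subr0.
  by move: (\prod_(y <- s') _) (\prod_y _) (ell F)^-1 => a b v; ring.
have vol_diff s' t' F :
    vol_at s' t' - vol_at s' (fun y => t' y - (y == F)%:Z) = vol_at (F :: s') t'.
  rewrite /vol_at -[F in F :: _](enum_rankK F) -mderiv_vol -Poch_eval_diff.
  congr (_ - Poch_eval _ _); apply/funext => k.
  rewrite -addrAC intrB; congr (_ - _).
  by rewrite (can2_eq enum_valK enum_rankK).
(* Beyond this length both sides vanish: more than [#|{: proper_flat M}|] factors kill the product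
   of [eta] classes, and more than [d] derivatives kill the volume polynomial. *)
suff H k s' t' : (#|{: proper_flat M}| + d.+1 <= size s' + k)%N ->
    snap s' t' = vol_at s' t' by apply: (H (#|{: proper_flat M}| + d.+1)%N); lia.
elim: k s' t' => [|k IH] s' t' hk.
  rewrite /snap /vol_at; have -> : vol s' = 0.
    apply/mpolyP => m; rewrite mcoeff_vol mcoeff0 /vol_coef; case: eqP => // e.
    by move: hk; rewrite -e; clear; lia.
  have := stratum_eta_eq0 xi_SR etaE (s := s') (C := set0).
  rewrite cards0 /stratum big_set0 mul1r => ->; last by move: hk; clear; lia.
  have chi0 : chi 0 = 0 by rewrite -(subrr 0) chiB subrr.
  by rewrite mul0r chi0 Poch_eval0.
apply/eqP; rewrite -subr_eq0; apply/eqP.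
pose H t0 := snap s' t0 - vol_at s' t0.
rewrite -[LHS]/(H t') (shift_invariant_const _ _ (fun F => - basis_vec M [set: E] F)).
  rewrite /H /snap chi_at_minus_uE /vol_at Poch_eval_at0 => [|l]; last first.
    by rewrite addNr.
  rewrite mcoeff_vol /vol_coef mdeg0 addn0; case: ifP => _; last by rewrite subrr.
  have -> : c_mnm 0 = 1 by rewrite /c_mnm big1 // => l _; rewrite mnm0E.
  have -> : (\prod_l ((0 : 'X_{1..n})%MM l)`! = 1)%N by rewrite big1 // => l _;
    rewrite mnm0E.
  by rewrite mulr1 divr1 subrr.
move=> t0 F; rewrite /H.
have := snap_diff s' t0 F; rewrite (IH (F :: s')); last by rewrite /= addSnnS.
by rewrite -vol_diff; lra.
Qed.

Hypothesis gr_mnm : forall m : 'X_{1..n}, mdeg m = d -> c_mnm m \in gr.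

(** Expand the power, take degrees termwise, and cancel [d!] against the multinomial
    coefficients. *)
Lemma meval_vol t :
  (vol [::]).@[fun k => (t (enum_val k))%:~R] =
    d`!%:R^-1 * (deg ((\sum_F c F *~ t F) ^+ d))%:~R.
Proof.
pose S : {mpoly int[n]} := (\sum_k 'X_k) ^+ d.
pose T (m : 'X_{1..n}) : int := \prod_k t (enum_val k) ^+ m k.
have -> : (\sum_F c F *~ t F) ^+ d =
    \sum_(m : 'X_{1..n < d.+1}) c_mnm m *~ (T m * S@_m).
  rewrite (big_enum_val (A := {: nonempty_flat M})) exp_sum_mcoeff.
  apply: eq_bigr => m _; rewrite mulrzA; congr (_ *~ _).
  rewrite -mulrzr /T rmorph_prod /c_mnm -big_split /=; apply: eq_bigr => k _.
  by rewrite -mulrzr exprMn rmorphXn.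
have S0 m : mdeg m != d -> S@_m = 0 by apply: dhomog_nemf_coeff (exp_sumX_homog n d).
rewrite (deg_sum gr0 grD degD) => [|m _]; last first.
  have [md|/S0->] := eqVneq (mdeg m) d; first by rewrite grMz // gr_mnm.
  by rewrite mulr0 mulr0z.
rewrite /vol raddf_sum rmorph_sum mulr_sumr; apply: eq_bigr => m _ /=.
rewrite mevalZ mevalX /vol_coef /= add0n big_nil mul1r.
have [md|/S0->] := eqVneq (mdeg m) d;
  last by rewrite mul0r mulr0 mulr0z (deg0 gr0 degD) mulr0.
rewrite (degMz gr0 grD degD grN) ?gr_mnm //.
have -> : \prod_k (t (enum_val k))%:~R ^+ m k = (T m)%:~R :> rat.
  by rewrite /T rmorph_prod; apply: eq_bigr => k _; rewrite rmorphXn.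
have := congr1 (fun z : int => z%:~R : rat) (mcoeff_exp_sumX md); rewrite -/S.
rewrite !rmorphM /= !rmorph_nat => e.
(* As [d!] is the product of the coefficient and the factorials of [m], both are nonzero and may be
   divided by. *)
have : (d`!%:R : rat) != 0 by rewrite pnatr_eq0 -lt0n fact_gt0.
rewrite -e mulf_eq0 negb_or => /andP[S0' u0]; field.
by rewrite S0' u0.
Qed.

End Main.

(** * Specialization to the Chow ring and the K-ring *)

Section Concrete.
Variables (E : finType) (M : matroid E).

Lemma meval_Poch_up (p : Lambda_poly M) v : (Poch_up p).@[v] = Poch_eval v p.
Proof.
rewrite /Poch_up /Poch_eval raddf_sum; apply: eq_bigr => m _ /=.
rewrite mevalZ rmorph_prod; congr (_ * _); apply: eq_bigr => k _.
rewrite rmorph_prod; apply: eq_bigr => j _.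
by rewrite /= mevalD mevalXU mevalC.
Qed.

Lemma eval_Lambda_shift u (p : Lambda_poly M) t :
  eval_Lambda (shift u p) t = p.@[fun k => (t (enum_val k) + u (enum_val k))%:~R].
Proof.
rewrite /eval_Lambda /shift comp_mpoly_meval; apply: meval_eq => k.
by rewrite tnth_mktuple mevalD mevalXU mevalC intrD.
Qed.

Lemma chow_graded_monomial C s (i : nonempty_flat M -> E) :
  stratum (@chow_D E M) C * \prod_(F <- s) c1 (L_divisor F (i F))
    \in chow_graded (#|C| + size s).
Proof.
apply: chow_gradedM.
  rewrite -sum1_card; apply: chow_graded_prod => G _; exact: chow_graded_D.
rewrite -sum1_size; apply: chow_graded_prod => F _; exact: chow_graded_c1.
Qed.

Lemma chow_graded_c_mnm (i : nonempty_flat M -> E) m :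
  c_mnm (fun F => c1 (L_divisor F (i F))) m \in chow_graded (mdeg m).
Proof.
rewrite mdegE; apply: chow_graded_prod => k _.
elim: (m k) => [|e IH]; first exact: chow_graded1.
by rewrite exprS -add1n; apply: chow_gradedM IH; apply: chow_graded_c1.
Qed.

End Concrete.

Theorem corollary1p5 (E : finType) (M : matroid E) (hM : loopless M)
    (deg : chow_ring M -> int) (hdeg : is_degree_map deg)
    (chi : K_ring M -> int) (hchi : is_euler_char chi)
    (i : nonempty_flat M -> E) (hi : forall F, i F \in val F) :
  exists snap vol : Lambda_poly M,
    [/\ forall t, eval_Lambda snap t = Snap chi i t,
        forall t, eval_Lambda vol t = Vol deg i t
      & snap = shift (basis_vec M [set: E]) (Poch_up vol)].
Proof.
have [degD deg1] := hdeg; have [chiD chi1] := hchi.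
pose c F := c1 (L_divisor F (i F)); pose ell F := K_O (L_divisor F (i F)).
(* The given point [i F] is traded for an arbitrary point of [F], since the argument chooses the
   point according to the chain. *)
have ellE (F : nonempty_flat M) j : j \in val F ->
    (ell F)^-1 = \prod_(G in L_support M j (val F)) (1 - K_xi G).
  by move=> jF; rewrite -K_O_L_divisor_inv /ell (K_O_L_divisor (hi F) jF).
have cE (F : nonempty_flat M) j : j \in val F ->
    c F = \sum_(G in L_support M j (val F)) chow_D G.
  by move=> jF; rewrite -c1_L_support /c (c1_L_divisor (hi F) jF).
have ell_unit F : ell F \is a GRing.unit by apply: K_O_unit.
have gr_stratum (C : {set proper_flat M}) s : (#|C| + size s = fan_dim M)%N ->
    stratum (@chow_D E M) C * \prod_(F <- s) c F \in chow_graded (fan_dim M).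
  by move=> <-; apply: chow_graded_monomial.
have grN : {in chow_graded (M := M) (fan_dim M),
    forall a, - a \in chow_graded (fan_dim M)}.
  by move=> a ha; rewrite -mulrN1z chow_gradedMz.
have grD : {in chow_graded (M := M) (fan_dim M) &,
    forall a b, a + b \in chow_graded (fan_dim M)}.
  by move=> a b ha hb; apply: chow_gradedD.
have snapE := snap_poch_vol hM (chow_graded0 M (fan_dim M)) grD degD
  (@chow_stratum_eq0 E M)
  cE gr_stratum deg1 chiD (@K_stratum_eq0 E M) ell_unit ellE chi1 [::].
have gr_mnm m : mdeg m = fan_dim M -> c_mnm c m \in chow_graded (fan_dim M).
  by move=> <-; apply: chow_graded_c_mnm.
have volE := meval_vol (chow_graded0 M (fan_dim M)) grD grN degD gr_mnm.
(* The snapper polynomial is taken to be the shifted transform, so what remains is that it takes the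
   values of [Snap]; this is [snapE], the case of an empty list. *)
exists (shift (basis_vec M [set: E]) (Poch_up (vol deg c [::]))), (vol deg c [::]).
split=> [t|t|//].
  rewrite eval_Lambda_shift meval_Poch_up -snapE /Snap.
  by rewrite big_nil mul1r.
by rewrite /eval_Lambda volE.
Qed.
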